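(* Let $M$ be a compact smooth manifold admitting a free circle action. Then there exist a $C^\infty$ diffeomorphism $f:M\to M$ and a family of scales $\{a_\chi\}$ such that $$\sup_{\mu\in\mathcal M(f)}h_{\mu,a_\chi}(f)<h_{\mathrm{top},a_\chi}(f),$$ where $\mathcal M(f)$ is the space of $f$-invariant Borel probability measures.
   Context: A family of scales is a family of functions $a_\chi:\mathbb R_+\to\mathbb R_+$, $\chi\in\mathbb R_+$, with $a_\chi(T)\to\infty$ as $T\to\infty$ and $a_\chi=o(a_{\chi'})$ whenever $\chi<\chi'$. Topological slow entropy of a homeomorphism $f$ of a compact metric space $X$: let $B_f^T(x,\epsilon)=\bigcap_{0\le t\le T}f^{-t}(B(f^t(x),\epsilon))$ ($t$ integer), let $N_{f,X}(\epsilon,T)$ be the minimal number of sets $B_f^T(x,\epsilon)$ needed to cover $X$, and $h_{\mathrm{top},a_\chi}(f)=\lim_{\epsilon\to0}\sup\{\chi:\limsup_{T\to\infty}N_{f,X}(\epsilon,T)/a_\chi(T)>0\}$ (with $\sup\emptyset=0$). Metric slow entropy for an $f$-invariant probability measure $\mu$: for a finite measurable partition $\mathcal P=\{P_1,\dots,P_k\}$ write $x_s=i$ if $f^s(x)\in P_i$, let $\bar d_{f,\mathcal P}^T(x,y)=\frac1T\#\{0\le s<T:x_s\ne y_s\}$, let $S(\mathcal P,T,\epsilon)$ be the minimal number of $\bar d_{f,\mathcal P}^T$-balls of radius $\epsilon$ whose union has $\mu$-measure $>1-\epsilon$, and $h_{\mu,a_\chi}(f)=\sup_{\mathcal P}\lim_{\epsilon\to0}\sup\{\chi:\limsup_{T\to\infty}S(\mathcal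 P,T,\epsilon)/a_\chi(T)>0\}$. *)

(* Defs.v *)
From HB Require Import structures.
From mathcomp Require Import all_boot all_order all_algebra finmap.
From mathcomp Require Import all_classical all_reals all_analysis.

Set Implicit Arguments.
Unset Strict Implicit.
Unset Printing Implicit Defensive.

Import Order.TTheory GRing.Theory Num.Theory.
Import numFieldNormedType.Exports.

Local Open Scope classical_set_scope.
Local Open Scope ring_scope.

(* For an open set U, f is C^(k+1) on U iff it is Frechet differentiable on U
   and x |-> 'd f x is C^k on U; in finite dimension the latter is tested on
   each vector v.  The values of f outside U play no role. *)
Fixpoint Ck_on (R : realType) (V W : normedModType R) (k : nat) (U : set V)
    (f : V -> W) : Prop :=
  match k with
  | 0%N => forall x, U x -> {for x, continuous f}
  | k'.+1 => (forall x, U x -> differentiable f x) /\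
             (forall v, Ck_on k' U (fun x => 'd f x v))
  end.

Definition smooth_on (R : realType) (V W : normedModType R) (U : set V)
  (f : V -> W) : Prop := forall k, Ck_on k U f.

(* A partial homeomorphism from X to the model space V, given by total
   functions that are only meaningful on cdom and ccod (see is_chart). *)
Record chart (R : realType) (V : normedModType R) (X : topologicalType) := Chart
  { cdom : set X ; ccod : set V ; cmap : X -> V ; cinv : V -> X }.

Definition is_chart (R : realType) (V : normedModType R) (X : topologicalType)
    (c : chart V X) : Prop :=
  [/\ open (cdom c) /\ open (ccod c),
      forall x, cdom c x -> ccod c (cmap c x) /\ cinv c (cmap c x) = x,
      forall v, ccod c v -> cdom c (cinv c v) /\ cmap c (cinv c v) = v,
      forall x, cdom c x -> {for x, continuous (cmap c)} &
      forall v, ccod c v -> {for v, continuous (cinv c)}].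

(* Not required to be maximal: an atlas and the maximal atlas containing it
   define the same smooth maps. *)
Definition smooth_atlas (R : realType) (V : normedModType R)
    (X : topologicalType) (A : set (chart V X)) : Prop :=
  [/\ forall c, A c -> is_chart c,
      forall x, exists2 c, A c & cdom c x &
      forall c d, A c -> A d ->
        smooth_on (ccod c `&` cinv c @^-1` cdom d) (cmap d \o cinv c)].

Definition smooth_map (R : realType) (V W : normedModType R)
    (X Y : topologicalType) (A : set (chart V X)) (B : set (chart W Y))
    (f : X -> Y) : Prop :=
  continuous f /\
  forall c d, A c -> B d ->
    smooth_on (ccod c `&` (f \o cinv c) @^-1` cdom d) (cmap d \o f \o cinv c).

Definition diffeomorphism (R : realType) (V : normedModType R)
    (X : topologicalType) (A : set (chart V X)) (f : X -> X) : Prop :=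
  smooth_map A A f /\
  exists g, [/\ cancel f g, cancel g f & smooth_map A A g].

Definition prod_chart (R : realType) (V W : normedModType R)
    (X Y : topologicalType) (c : chart V X) (d : chart W Y) :
    chart (V * W)%type (X * Y)%type :=
  Chart (cdom c `*` cdom d) (ccod c `*` ccod d)
        (fun p => (cmap c p.1, cmap d p.2)) (fun p => (cinv c p.1, cinv d p.2)).

Definition prod_atlas (R : realType) (V W : normedModType R)
    (X Y : topologicalType) (A : set (chart V X)) (B : set (chart W Y)) :
    set (chart (V * W)%type (X * Y)%type) :=
  [set e | exists c d, [/\ A c, B d & e = prod_chart c d]].

Definition line_atlas (R : realType) : set (chart R^o R^o) :=
  [set Chart setT setT id id].

(* The circle is the Lie group R/Z: an action of it is an action of (R, +) for
   which 1 acts trivially, it is smooth iff the lift to the covering R of R/Z is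
   smooth, and it is free iff only integers have fixed points. *)
Definition free_circle_action (R : realType) (V : normedModType R)
    (X : topologicalType) (A : set (chart V X)) (S : R -> X -> X) : Prop :=
  [/\ forall x, S 0 x = x,
      forall s t x, S (s + t) x = S s (S t x),
      forall x, S 1 x = x,
      forall t x, S t x = x -> t \is a Num.int &
      smooth_map (prod_atlas (@line_atlas R) A) A (fun p => S p.1 p.2)].

(* Here R_+ = ]0, +oo[, so that T^chi is a family of scales; a chi T is
   meaningful for chi, T > 0 only. *)
Definition scale_family (R : realType) (a : R -> R -> R) : Prop :=
  [/\ forall chi T, 0 < chi -> 0 < T -> 0 < a chi T,
      forall chi, 0 < chi -> a chi T @[T --> +oo] --> +oo &
      forall chi chi', 0 < chi -> chi < chi' ->
        a chi T / a chi' T @[T --> +oo] --> 0].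

(* sup {chi > 0 | limsup_(T -> +oo) u(T) / a_chi(T) > 0}, T real; adding 0 to the
   set implements the convention that the supremum of the empty set is 0. *)
Definition growth_exponent (R : realType) (a : R -> R -> R) (u : R -> \bar R) :
    \bar R :=
  ereal_sup (0%E |` [set chi%:E | chi in [set chi : R | 0 < chi /\
    (0 < limf_esup (fun T => u T * ((a chi T)^-1)%:E) (pinfty_nbhs R))%E]]).

Section TopologicalSlowEntropy.
Context {R : realType} {X : metricType R} (a : R -> R -> R) (f : X -> X).

Definition bowen_ball (T : R) (x : X) (eps : R) : set X :=
  [set y | forall t : nat, t%:R <= T -> ball (iter t f x) eps (iter t f y)].

Definition covering_number (eps T : R) : \bar R :=
  ereal_inf [set (size s)%:R%:E | s in
    [set s : seq X | forall y, exists2 x, x \in s & bowen_ball T x eps y]].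

Definition htop : \bar R :=
  lim (growth_exponent a (covering_number eps) @[eps --> 0^'+]).

End TopologicalSlowEntropy.

(* The library builds measurable spaces on pointed types only; the points play
   no role besides nonemptiness. *)
#[short(type="pmetricType")]
HB.structure Definition PointedMetric (K : numDomainType) :=
  {T of Metric K T & Pointed T}.

Definition borel (X : ptopologicalType) := g_sigma_algebraType (@open X).

Section MetricSlowEntropy.
Context {R : realType} {X : ptopologicalType} (a : R -> R -> R) (f : X -> X).

Definition invariant_probabilities : set (probability (borel X) R) :=
  [set mu : probability (borel X) R |
    forall B : set (borel X), measurable B -> mu (f @^-1` B) = mu B].

Definition measurable_partition (k : nat) (P : 'I_k -> set (borel X)) : Prop :=
  (forall i, measurable (P i)) /\ partition setT P setT.

Definition hamming (k : nat) (P : 'I_k -> set (borel X)) (T : R) (x y : X) : R :=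
  #|` fset_set [set s : nat | s%:R < T /\
        ~ exists i, P i (iter s f x) /\ P i (iter s f y)]|%:R / T.

Definition hamming_ball (k : nat) (P : 'I_k -> set (borel X)) (T : R) (x : X)
    (eps : R) : set (borel X) :=
  [set y | hamming P T x y < eps].

Definition hamming_covering_number (mu : probability (borel X) R) (k : nat)
    (P : 'I_k -> set (borel X)) (eps T : R) : \bar R :=
  ereal_inf [set (size s)%:R%:E | s in [set s : seq X |
    ((1 - eps)%:E < mu (\bigcup_(x in [set` s]) hamming_ball P T x eps))%E]].

Definition hmu (mu : probability (borel X) R) : \bar R :=
  ereal_sup [set h | exists (k : nat) (P : 'I_k -> set (borel X)),
    measurable_partition P /\
    h = lim (growth_exponent a (hamming_covering_number mu P eps)
               @[eps --> 0^'+])].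

End MetricSlowEntropy.

(* Main.v *)
Require Import Defs.
From HB Require Import structures.
From mathcomp Require Import all_boot all_order all_algebra finmap.
From mathcomp Require Import all_classical all_reals all_analysis.
Set Implicit Arguments.
Unset Strict Implicit.
Unset Printing Implicit Defensive.
From mathcomp Require Import ring lra zify.
Import Order.TTheory GRing.Theory Num.Theory.
Import numFieldNormedType.Exports.
Local Open Scope classical_set_scope.
Local Open Scope ring_scope.

(** The diffeomorphism [f] is supported in one chart, where it is
    [v |-> v + phi v *: e_0] for a smooth bump function [phi] with small
    derivative. A moved point has strictly increasing first coordinate along its
    orbit, so no invariant probability measure charges the moved points: it lives
    on the fixed points of [f], where the Hamming pseudometrics see only the
    partition, and the Hamming covering numbers stay bounded in [T]. On the other
    hand a moved point is isolated in its own orbit, so its preimages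
    [f^-j p], [j <= T], are separated by time [T] and the topological covering
    numbers are at least [T]. With [a_chi(T) = T^chi] the metric slow entropies
    vanish while the topological one is at least 1. The circle action only serves
    to exclude dimension 0. *)

(** * Calculus of maps of class C^k on an open set *)

Section Ck_calculus.
Context {R : realType}.
Implicit Types (V W Z : normedModType R).

(** The first-order expansion of [f] at [x] is also one of [g], and the linear part of such an
    expansion is unique. *)
Lemma is_diff_near_eq V W (f g : V -> W) (x : V) :
  {near x, f =1 g} -> differentiable f x -> is_diff x g ('d f x).
Proof.
move=> fg df; have fgx : f x = g x by exact: nbhs_singleton fg.
have dg : g \o shift x = cst (g x) + 'd f x +o_ 0 id.
  apply/eqaddoP => e e0; have /eqaddoP/(_ e e0) := diff_locally df.
  have fg0 : \forall h \near 0, f (h + x) = g (h + x).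
    by move: fg; rewrite (near_shift 0 x) subr0.
  by apply: filterS2 fg0 => h /= fgh; rewrite !fctE /= fgx fgh.
have dE := diff_unique (diff_continuous df) dg.
by split=> //; apply/diff_locallyP; rewrite dE; split=> //; exact: diff_continuous.
Qed.

Lemma Ck_onSn k V W (U : set V) (f : V -> W) : Ck_on k.+1 U f -> Ck_on k U f.
Proof.
elim: k f => [|k IH] f /= [df Hf].
  by move=> x Ux; apply: differentiable_continuous; exact: df.
by split=> // v; apply: IH; exact: Hf.
Qed.

Lemma Ck_on_subset k V W (U U' : set V) (f : V -> W) :
  U `<=` U' -> Ck_on k U' f -> Ck_on k U f.
Proof.
move=> UU'; elim: k f => [|k IH] f /=.
  by move=> Hf x Ux; apply: Hf; exact: UU'.
move=> [df Hf]; split=> [x Ux|v]; first by apply: df; exact: UU'.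
exact: IH.
Qed.

Lemma Ck_on_points k V W (U : set V) (f : V -> W) :
  (forall x, U x -> exists2 U', Ck_on k U' f & U' x) -> Ck_on k U f.
Proof.
elim: k f => [|k IH] f /= Hf.
  by move=> x /Hf[U' + U'x]; exact.
split=> [x /Hf[U' [df _] U'x]|v]; first exact: df.
by apply: IH => x /Hf[U' [_ ?] U'x]; exists U'.
Qed.

(** Openness turns equality on [U] into equality near each point, so the differentials agree on [U]
    as well and the induction continues. The closure properties below compute a differential
    pointwise and then transfer regularity through this lemma. *)
Lemma Ck_on_eq k V W (U : set V) (f g : V -> W) :
  open U -> {in U, f =1 g} -> Ck_on k U f -> Ck_on k U g.
Proof.
move=> oU; elim: k f g => [|k IH] f g fg /=.
  move=> Hf x Ux.
  have nfg : {near x, f =1 g}.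
    by apply: filterS (open_nbhs_nbhs (conj oU Ux)) => y Uy; apply: fg; rewrite inE.
  rewrite /prop_for /continuous_at -(nbhs_singleton nfg).
  by apply: cvg_trans (Hf x Ux); exact: near_eq_cvg.
move=> [df Hf].
have dg x : U x -> is_diff x g ('d f x).
  move=> Ux; apply: is_diff_near_eq; last exact: df.
  by apply: filterS (open_nbhs_nbhs (conj oU Ux)) => y Uy; apply: fg; rewrite inE.
split=> [x Ux|v]; first by have [] := dg x Ux.
by apply: IH (Hf v) => x /set_mem Ux; have [_ ->] := dg x Ux.
Qed.

Lemma Ck_on_cst k V W (U : set V) (w : W) : Ck_on k U (fun=> w).
Proof.
elim: k w => [|k IH] w /=; first by move=> x _; exact: cst_continuous.
split=> [x _|v]; first exact: differentiable_cst.
rewrite (_ : (fun x => _) = fun=> 0) //; apply/funext => x.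
by rewrite diff_cst.
Qed.

Lemma Ck_on_lin k V W (U : set V) (L : {linear V -> W}) :
  continuous L -> Ck_on k U L.
Proof.
move=> cL; case: k => [|k] /=; first by move=> x _; exact: cL.
split=> [x _|v]; first exact: linear_differentiable.
rewrite (_ : (fun x => _) = fun=> L v); first exact: Ck_on_cst.
by apply/funext => x; rewrite diff_lin.
Qed.

Lemma Ck_on_id k V (U : set V) : Ck_on k U id.
Proof. by apply: (@Ck_on_lin k V V U idfun) => x; exact: cvg_id. Qed.

Lemma Ck_onD k V W (U : set V) (f g : V -> W) : open U ->
  Ck_on k U f -> Ck_on k U g -> Ck_on k U (f + g).
Proof.
move=> oU; elim: k f g => [|k IH] f g /=.
  by move=> Hf Hg x Ux; apply: continuousD; [exact: Hf|exact: Hg].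
move=> [df Hf] [dg Hg]; split=> [x Ux|v].
  by apply: differentiableD; [exact: df|exact: dg].
apply: Ck_on_eq (IH _ _ (Hf v) (Hg v)) => // x /set_mem Ux.
by rewrite diffD //; [exact: df|exact: dg].
Qed.

Lemma Ck_on_linl k V W Z (U : set V) (L : {linear W -> Z}) (f : V -> W) :
  open U -> continuous L -> Ck_on k U f -> Ck_on k U (L \o f).
Proof.
move=> oU cL; elim: k f => [|k IH] f /=.
  by move=> Hf x Ux; apply: continuous_comp; [exact: Hf|exact: cL].
move=> [df Hf]; split=> [x Ux|v].
  by apply: differentiable_comp; [exact: df|exact: linear_differentiable].
apply: Ck_on_eq (IH _ (Hf v)) => // x /set_mem Ux.
rewrite diff_comp //=; [|exact: df|exact: linear_differentiable].
by rewrite diff_lin.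
Qed.

(** Leibniz rule, read off the differential of the continuous bilinear map [B] composed with the
    pair [(a, f)]. *)
Lemma is_diff_scale V W (a : V -> R) (f : V -> W) (x : V) :
  differentiable a x -> differentiable f x ->
  is_diff x (fun y => a y *: f y) (fun v => a x *: 'd f x v + 'd a x v *: f x).
Proof.
move=> da df.
pose B : R^o -> W -> W := fun k w => k *: w.
have Bbil : bilinear_for *:%R *:%R B.
  split=> [u'|u] b y z /=; rewrite /B; first by rewrite scalerDl scalerA.
  by rewrite scalerDr !scalerA mulrC.
pose BM := @bilinear_isBilinear.Build _ _ _ _ _ _ B Bbil.
pose BB : {bilinear R^o -> W -> W} := HB.pack B BM.
have cB : continuous (fun p : R^o * W => BB p.1 p.2).
  move=> p; apply: continuousZ; [exact: cvg_fst|exact: cvg_snd].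
have dB := @differentiable_bilin _ _ _ _ BB (a x, f x) cB.
have dp : differentiable (fun y => (a y : R^o, f y)) x by exact: differentiable_pair.
rewrite (_ : (fun y => _) =
  (fun p : R^o * W => BB p.1 p.2) \o (fun y => (a y : R^o, f y))) //.
split; first exact: differentiable_comp.
by rewrite diff_comp // diff_bilin // diff_pair.
Qed.

Lemma Ck_onZ k V W (U : set V) (a : V -> R) (f : V -> W) : open U ->
  Ck_on k U a -> Ck_on k U f -> Ck_on k U (fun x => a x *: f x).
Proof.
move=> oU; elim: k a f => [|k IH] a f /=.
  by move=> Ha Hf x Ux; apply: continuousZ; [exact: Ha|exact: Hf].
move=> [da Ha] [df Hf].
have D x : U x -> is_diff x (fun y => a y *: f y)
    (fun v => a x *: 'd f x v + 'd a x v *: f x).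
  by move=> Ux; apply: is_diff_scale; [exact: da|exact: df].
split=> [x Ux|v]; first by have [] := D x Ux.
have Ck_a : Ck_on k U a by apply: Ck_onSn.
have Ck_f : Ck_on k U f by apply: Ck_onSn.
apply: Ck_on_eq (Ck_onD oU (IH _ _ Ck_a (Hf v)) (IH _ _ (Ha v) Ck_f)) => //.
by move=> x /set_mem Ux; have [_ ->] := D x Ux.
Qed.

Lemma Ck_on_sum k V W (U : set V) m (f : 'I_m -> V -> W) : open U ->
  (forall i, Ck_on k U (f i)) -> Ck_on k U (fun x => \sum_(i < m) f i x).
Proof.
move=> oU Hf; rewrite (_ : (fun x => _) = \sum_(i < m) f i); last first.
  by apply/funext => x; rewrite fct_sumE.
by elim/big_ind: _ => //; [exact: Ck_on_cst|move=> *; exact: Ck_onD].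
Qed.

Lemma Ck_on_coord k V m (U : set V) (f : V -> 'rV[R]_m) (i : 'I_m) : open U ->
  Ck_on k U f -> Ck_on k U (fun x => f x ord0 i).
Proof.
move=> oU Hf.
have lin : linear (fun w : 'rV[R]_m => w ord0 i : R^o).
  by move=> c u v; rewrite !mxE.
pose LM := GRing.isLinear.Build _ _ _ _ _ lin.
pose L : {linear 'rV[R]_m -> R^o} := HB.pack (fun w : 'rV[R]_m => w ord0 i : R^o) LM.
have cL : continuous L by exact: coord_continuous.
exact: (Ck_on_linl oU cL Hf).
Qed.

(** In the chain rule the vector fed to ['d g (f x)] depends on [x], whereas [Ck_on] tests fixed
    vectors only. Expanding it in the standard basis of the intermediate row space gives a finite
    sum of products, with the partial derivatives of [g] composed with [f] handled by induction. *)
Lemma Ck_on_comp k V Z m (U : set V) (U' : set 'rV[R]_m) (f : V -> 'rV[R]_m)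
    (g : 'rV[R]_m -> Z) : open U -> (forall x, U x -> U' (f x)) ->
  Ck_on k U f -> Ck_on k U' g -> Ck_on k U (g \o f).
Proof.
move=> oU fU; elim: k g => [|k IH] g.
  by move=> Hf Hg x Ux; apply: continuous_comp; [exact: Hf|exact/Hg/fU].
move=> /[dup] Hf [df df'] [dg dg'].
split=> [x Ux|v].
  by apply: differentiable_comp; [exact: df|exact/dg/fU].
apply: (@Ck_on_eq _ _ _ _ (fun x => \sum_(i < m)
  'd f x v ord0 i *: 'd g (f x) (delta_mx ord0 i))) => //.
  move=> x /set_mem Ux; rewrite (diff_comp (df _ Ux) (dg _ (fU _ Ux))).
  rewrite /= [in RHS](row_sum_delta ('d f x v)) linear_sum.
  by apply: eq_bigr => i _; rewrite linearZ.
apply: Ck_on_sum => // i; apply: Ck_onZ => //.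
  by apply: Ck_on_coord => //; exact: df'.
apply: (IH (fun y => 'd g y (delta_mx ord0 i))); last exact: dg'.
exact: Ck_onSn.
Qed.

(** The differential is [- u^-2 * 'd u], whose only new factor is again the inverse of [u], known to
    be C^k by induction. *)
Lemma Ck_onV k V (U : set V) (u : V -> R) : open U ->
  (forall x, U x -> u x != 0) -> Ck_on k U u -> Ck_on k U (fun x => (u x)^-1).
Proof.
move=> oU u0; elim: k u u0 => [|k IH] u u0.
  by move=> Hu x Ux; apply: continuousV; [exact: u0|exact: Hu].
move=> /[dup] Hu [du du']; split=> [x Ux|v].
  by apply: differentiableV; [exact: du|exact: u0].
have iu := IH _ u0 (Ck_onSn Hu).
apply: (@Ck_on_eq _ _ _ _ (fun x =>
  (- 1 : R) *: ((u x)^-1 *: ((u x)^-1 *: 'd u x v : R^o)))) => //.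
  move=> x /set_mem Ux.
  have dV : 'd (fun y => (u y)^-1) x v = - (u x) ^- 2 * 'd u x v.
    by have /funeqP/(_ v) := diffV (du _ Ux) (u0 _ Ux).
  by rewrite [RHS]dV /GRing.scale /= expr2 invfM mulN1r mulNr mulrA.
apply: Ck_onZ => //; first exact: Ck_on_cst.
by do 2!apply: Ck_onZ => //; exact: du'.
Qed.

End Ck_calculus.

(** * Functions that are flat at 0 *)

Section flat_functions.
Context {R : realType}.

(** [flat 0] is the classical exp(-1/x) extended by 0. The extra powers of 1/x make the linear span
    of the family stable under differentiation. *)
Definition flat (m : nat) (x : R) : R :=
  if 0 < x then x^-1 ^+ m * expR (- x^-1) else 0.

Lemma flat_ge0 m x : 0 <= flat m x.
Proof.
rewrite /flat; case: ifP => // x0.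
by rewrite mulr_ge0 ?expR_ge0 // exprn_ge0 // invr_ge0 ltW.
Qed.

(** With u = 1/x, the term of degree m+2 of the exponential series bounds exp(u) from below. The
    quadratic bound gives derivative 0 at the origin. *)
Lemma flat_le_sqr m x : flat m x <= m.+2`!%:R * x ^+ 2.
Proof.
have F0 : (0 : R) < m.+2`!%:R by rewrite ltr0n fact_gt0.
rewrite /flat; case: ifPn => [x0|_]; last by rewrite mulr_ge0 ?sqr_ge0 // ltW.
have u0 : 0 < x^-1 by rewrite invr_gt0.
have /= := @expR_ge1Dxn R x^-1 m.+1 (ltW u0).
rewrite expRN ler_pdivrMr ?expR_gt0 // => expu.
have -> : x^-1 ^+ m = x^-1 ^+ m.+2 * x ^+ 2.
  by rewrite -addn2 exprD -mulrA -exprMn mulVf ?gt_eqF // expr1n mulr1.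
rewrite [leRHS]mulrAC; apply: ler_wpM2r; first exact: sqr_ge0.
rewrite mulrC -ler_pdivrMr // (le_trans _ expu) // ler_wpDl //.
Qed.

Lemma is_derive_flat m (x : R) :
  is_derive x 1 (flat m) (flat m.+2 x - m%:R * flat m.+1 x).
Proof.
have [x0|x0|->] := ltgtP x 0.
- have : is_derive x (1 : R) (cst (0 : R)) 0 by exact: is_derive_cst.
  rewrite {2}/flat {2}/flat [0 < x]ltNge (ltW x0) /= mulr0 subr0.
  apply: near_eq_is_derive.
  apply: filterS (lt_nbhsl x0) => y y0.
  by rewrite /flat ltNge (ltW y0).
- have xn0 : x != 0 by rewrite gt_eqF.
  have dinv : derivable (GRing.inv : R -> R) x 1.
    exact/derivable1_diffP/differentiable_Rinv.
  have iinv : is_derive x 1 (GRing.inv : R -> R) (- x ^- 2).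
    split=> //; rewrite deriveE; last exact/differentiable_Rinv.
    by rewrite diff_Rinv //= [LHS]mulr1.
  have iexp : is_derive x 1 (expR \o (- (GRing.inv : R -> R))) (x ^- 2 * expR (- x^-1)).
    have dN : derivable (- (GRing.inv : R -> R)) x 1 by exact: derivableN.
    split.
      apply/derivable1_diffP/differentiable_comp; first exact/derivable1_diffP.
      apply/derivable1_diffP; exact: (@derivable_expR R).
    rewrite -derive1E (derive1_comp dN (@derivable_expR R _)).
    have dexp y : 'D_1 expR y = expR y :> R by rewrite -[in RHS]derive_expR.
    by rewrite !derive1E dexp deriveN // derive_val opprK mulrC.
  have : is_derive x 1 ((GRing.inv : R -> R) ^+ m * (expR \o (- (GRing.inv : R -> R))))
      (flat m.+2 x - m%:R * flat m.+1 x).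
    have iX := is_deriveX m iinv.
    apply: is_derive_eq (is_deriveM iX iexp) _.
    rewrite /flat x0 /= exprfctE -exprVn [(- _) x]/(- x^-1) /GRing.scale /=.
    by case: (m) => [|k]; rewrite /= ?mul0r !exprS; ring.
  apply: near_eq_is_derive.
  apply: filterS (lt_nbhsr x0) => y y0.
  rewrite /flat y0 -[LHS]/((GRing.inv ^+ m) y * expR (- y^-1)).
  by rewrite exprfctE.
- have f0 l : flat l 0 = 0 by rewrite /flat ltxx.
  rewrite !f0 mulr0 subr0.
  have F0 : (0 : R) < m.+2`!%:R by rewrite ltr0n fact_gt0.
  have cv : h^-1 *: ((flat m \o shift 0) (h *: 1) - flat m 0) @[h --> 0^'] --> (0 : R).
    apply/cvgrPdist_le => e e0.
    near=> h.
    have h0 : h != 0 by near: h; exact: nbhs_dnbhs_neq.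
    have he : `|h| <= e / m.+2`!%:R by near: h; apply: dnbhs0_le; exact: divr_gt0.
    rewrite sub0r normrN f0 subr0 /= addr0 [h%:A]mulr1 normrZ normfV.
    rewrite (ger0_norm (flat_ge0 _ _)) ler_pdivrMl ?normr_gt0 //.
    apply: le_trans (flat_le_sqr _ _) _; rewrite -real_normK ?num_real //.
    rewrite expr2 mulrCA; apply: ler_wpM2l => //.
    by rewrite mulrC -ler_pdivlMr.
  by split; [apply/cvg_ex; exists 0|exact/cvg_lim].
Unshelve. all: by end_near. Qed.

(** Induction on [k] for all [m] at once, since differentiating [flat m] brings in [flat m.+1] and
    [flat m.+2]. *)
Lemma Ck_on_flat_comp k (V : normedModType R) (U : set V) (q : V -> R) m :
  open U -> smooth_on U q -> Ck_on k U (flat m \o q).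
Proof.
move=> oU sq; have dflat l x : differentiable (flat l : R -> R) x.
  by apply/derivable1_diffP; have [] := is_derive_flat l x.
have dq x : U x -> differentiable q x by have [d _] := sq 1%N; exact: d.
elim: k m => [|k IH] m.
  move=> x Ux; apply: continuous_comp; first exact/differentiable_continuous/dq.
  exact/differentiable_continuous/dflat.
split=> [x Ux|v]; first by apply: differentiable_comp; [exact: dq|exact: dflat].
have Dq : Ck_on k U (fun x => 'd q x v) by have [_] := sq k.+1; exact.
apply: (@Ck_on_eq _ _ _ _ _ (fun x => 'd q x v *:
   ((flat m.+2 \o q) x + (- m%:R : R) *: (flat m.+1 \o q) x : R^o))) => //.
  move=> x /set_mem Ux; rewrite (diff_comp (dq _ Ux) (dflat _ _)) /=.
  rewrite diff1E // derive1E; congr (_ *: _).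
  by have [_ ->] := is_derive_flat m (q x); rewrite scaleNr.
apply: Ck_onZ => //; apply: Ck_onD => //.
by apply: Ck_onZ => //; exact: Ck_on_cst.
Qed.

End flat_functions.

(** * Bump functions with small differential *)

Section bump.
Context {R : realType} {n : nat}.
Implicit Types (phi : 'rV[R]_n -> R) (v w : 'rV[R]_n).

Lemma coord_le_norm v (i : 'I_n) : `|v ord0 i| <= `|v|.
Proof. by rewrite [leRHS]/Num.Def.normr /= mx_normrE (le_bigmax _ _ (ord0, i)). Qed.

Lemma closed_ball_rV_compact v (r : R) : 0 < r -> compact (closed_ball v r).
Proof.
move=> r0; apply: bounded_closed_compact; last exact: closed_ball_closed.
exists (`|v| + r); split; first exact: num_real.
move=> s vs w; rewrite closed_ballE // /closed_ball_ /= => vw.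
rewrite -(subrK v w) (le_trans (ler_normD _ _)) // addrC.
by rewrite (le_trans _ (ltW vs)) // lerD2l distrC.
Qed.

(** Mean value theorem for [phi] along the segment from [w] to [v]. *)
Lemma lipschitz_of_diff_le phi (C : R) :
  (forall v, differentiable phi v) -> (forall v h, `|'d phi v h| <= C * `|h|) ->
  forall v w, `|phi v - phi w| <= C * `|v - w|.
Proof.
move=> dphi leC v w.
pose l (t : R) : 'rV[R]_n := t *: (v - w) + w.
have dl t : is_diff t l ( *:%R^~ (v - w)).
  apply: is_diff_eq.
  by rewrite addr0.
have der (t : R) : is_derive t 1 (phi \o l) ('d phi (l t) (v - w)).
  have dpl : differentiable (phi \o l) t by apply: differentiable_comp.
  split; first exact: diff_derivable.
  rewrite deriveE // diff_comp //= (@diff_val _ _ _ _ _ _ _ (dl t)).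
  by rewrite scale1r.
have cont : {within `[0, 1], continuous (phi \o l)}.
  apply: continuous_subspaceT => t.
  by apply/differentiable_continuous/derivable1_diffP; have [] := der t.
have [t _] := MVT_segment ler01 (fun t _ => der t) cont.
rewrite /l /= scale1r scale0r subrK add0r => ->.
by rewrite subr0 mulr1.
Qed.

(** The sum [N] of the absolute partial derivatives is continuous and bounds the differential, so
    its maximum on [K] serves there. Off [K] the function vanishes on an open set, hence so does its
    differential. *)
Lemma compact_support_diff_bound phi (K : set 'rV[R]_n) :
  compact K -> smooth_on setT phi -> (forall v, ~ K v -> phi v = 0) ->
  exists2 C : R, 0 < C & forall v h, `|'d phi v h| <= C * `|h|.
Proof.
move=> cK sphi phi0.
have [dphi _] := sphi 1%N.
have {}dphi v : differentiable phi v by exact: dphi.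
pose N v := \sum_(i < n) `|'d phi v (delta_mx ord0 i)|.
have cN : continuous N.
  apply: continuous_big => [|i _ v]; first exact: add_continuous.
  apply: (@continuous_comp _ _ _ (fun v => 'd phi v (delta_mx ord0 i)) Num.norm v).
    by have [_ /(_ (delta_mx ord0 i)) c] := sphi 1%N; exact: c.
  exact: norm_continuous.
have leN v h : `|'d phi v h| <= N v * `|h|.
  rewrite [in leLHS](row_sum_delta h) linear_sum mulr_suml.
  apply: le_trans (ler_norm_sum _ _ _) _; apply: ler_sum => i _.
  rewrite linearZ /= normrM mulrC; apply: ler_wpM2l => //; exact: coord_le_norm.
have N0 v : 0 <= N v by apply: sumr_ge0.
have [C C0 HC] : exists2 C : R, 0 < C & forall v, K v -> N v <= C.
  have [K0|/set0P nK] := eqVneq K set0; first by exists 1 => // v; rewrite K0.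
  have [c _ Hc] := compact_EVT_max nK cK (continuous_subspaceT cN).
  exists (N c + 1); first by rewrite ltr_wpDl.
  by move=> v Kv; rewrite (le_trans (Hc v _)) ?inE // lerDl.
exists C => // v h; have [Kv|nKv] := pselect (K v).
  by apply: le_trans (leN _ _) _; apply: ler_wpM2r => //; exact: HC.
have oK : open (~` K) by apply: closed_openC; exact: compact_closed (@norm_hausdorff _ _) cK.
have : {near v, cst (0 : R) =1 phi}.
  by apply: filterS (open_nbhs_nbhs (conj oK nKv)) => w /phi0 ->.
move=> /is_diff_near_eq/(_ (differentiable_cst _ _))[_ ->].
by rewrite diff_cst normr0 mulr_ge0 // ltW.
Qed.

Lemma smooth_on_sqr_dist (U : set 'rV[R]_n) (c : 'rV[R]_n) (r : R) : open U ->
  smooth_on U (fun v => r - \sum_(i < n) (v ord0 i - c ord0 i) ^+ 2).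
Proof.
move=> oU k.
apply: (@Ck_on_eq _ _ _ _ _ ((fun=> r) + (fun v => (-1 : R) *:
   (\sum_(i < n) (v ord0 i - c ord0 i) *: (v ord0 i - c ord0 i : R^o))))) => //.
  move=> v _; rewrite -[LHS]/(_ + _) scaleN1r; congr (_ - _).
apply: Ck_onD => //; first exact: Ck_on_cst.
apply: Ck_onZ => //; first exact: Ck_on_cst.
apply: Ck_on_sum => // i.
have : Ck_on k U (fun v : 'rV[R]_n => (v - c) ord0 i).
  apply: (@Ck_on_coord _ k _ n U (fun v => v - c)) => //.
  by apply: (@Ck_onD _ _ _ _ _ id (fun=> - c)) => //; [exact: Ck_on_id|exact: Ck_on_cst].
rewrite (_ : (fun v => _) = (fun v : 'rV[R]_n => v ord0 i - c ord0 i)).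
  by move=> ?; exact: Ck_onZ.
by apply/funext => v; rewrite !mxE.
Qed.

Lemma smooth_bump (U : set 'rV[R]_n) (c : 'rV[R]_n) : open U -> U c ->
  exists phi (K : set 'rV[R]_n),
  [/\ smooth_on setT phi, (forall v, 0 <= phi v) /\ 0 < phi c,
      compact K /\ K `<=` U, forall v, ~ K v -> phi v = 0 &
      forall v h, `|'d phi v h| <= 2^-1 * `|h|].
Proof.
move=> oU Uc.
have [r r0 rU] : exists2 r : R, 0 < r & closed_ball c r `<=` U.
  by have /nbhs_closedballP[r rU] := open_nbhs_nbhs (conj oU Uc); exists r%:num.
(* A sum of squares is used because the sup norm defining the balls is in general not smooth.
   Outside the closed ball one coordinate alone exceeds [r] in absolute value, so [q] is not
   positive there. *)
pose q v := r ^+ 2 - \sum_(i < n) (v ord0 i - c ord0 i) ^+ 2.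
pose psi := flat 0 \o q.
have spsi : smooth_on setT psi.
  move=> k; apply: Ck_on_flat_comp; first exact: openT.
  by apply: smooth_on_sqr_dist; exact: openT.
have psi0 v : ~ closed_ball c r v -> psi v = 0.
  rewrite (closed_ballE _ r0) /closed_ball_ /= => /negP; rewrite -ltNge => rv.
  rewrite /psi /= /flat ifF //; apply/negbTE; rewrite -leNgt /q subr_le0.
  have [i Hi] : exists i : 'I_n, r < `|v ord0 i - c ord0 i|.
    apply: contrapT => H; move: rv; rewrite ltNge => /negP; apply.
    rewrite distrC {1}/Num.Def.normr /= mx_normrE; apply/bigmax_leP.
    split=> [|[j i] _ /=]; first exact: ltW.
    by rewrite leNgt; apply/negP => Hi; apply: H; exists i; move: Hi; rewrite !mxE (ord1 j).
  rewrite (bigD1 i) //= -[leLHS]addr0; apply: lerD; last first.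
    by apply: sumr_ge0 => j _; exact: sqr_ge0.
  by rewrite -[leRHS]real_normK ?num_real // ler_sqr ?nnegrE // ltW.
have [C C0 HC] := compact_support_diff_bound (closed_ball_rV_compact r0) spsi psi0.
(* Rescaling by [d] brings the bound [C] on the differential down to 1/2. *)
pose d := (2 * C)^-1.
have d0 : 0 < d by rewrite invr_gt0 mulr_gt0.
exists (fun v => d *: (psi v : R^o)), (closed_ball c r); split.
- move=> k; apply: Ck_onZ; [exact: openT|exact: Ck_on_cst|exact: spsi].
- split; first by move=> v; rewrite mulr_ge0 ?(ltW d0) //; exact: flat_ge0.
  rewrite mulr_gt0 // /psi /q /= big1; last by move=> i _; rewrite subrr expr0n.
  by rewrite subr0 /flat exprn_gt0 // mulr_gt0 // expR_gt0.
- by split=> //; exact: closed_ball_rV_compact.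
- by move=> v /psi0 ->; rewrite scaler0.
- move=> v h; have dpsi : differentiable psi v.
    by have [dp _] := spsi 1%N; exact: dp.
  rewrite (_ : (fun v => _) = d *: psi) // diffZ //= normrM gtr0_norm //.
  by rewrite /d invfM -mulrA ler_pM2l // ler_pdivrMl.
Qed.

End bump.

(** * Pushing along a fixed vector is a diffeomorphism of the model space *)

Section perturbation_of_identity.
Context {R : realType} {n : nat} (phi : 'rV[R]_n -> R) (e : 'rV[R]_n).
Hypothesis sphi : smooth_on setT phi.
Hypothesis dphi_le : forall v h, `|'d phi v h| <= 2^-1 * `|h|.
Hypothesis e1 : `|e| <= 1.

Definition push (v : 'rV[R]_n) : 'rV[R]_n := v + phi v *: e.

Let dphi v : differentiable phi v.
Proof. by have [d _] := sphi 1%N; exact: d. Qed.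

Let lip := lipschitz_of_diff_le dphi dphi_le.

Lemma smooth_push : smooth_on setT push.
Proof.
move=> k; apply: (@Ck_onD _ _ _ _ _ id (fun v => phi v *: e)); first exact: openT.
  exact: Ck_on_id.
apply: Ck_onZ; [exact: openT|exact: sphi|exact: Ck_on_cst].
Qed.

(** [phi] has Lipschitz constant 1/2 and [e] has norm at most 1, so the perturbation cancels at most
    half of the distance. This yields injectivity and a Lipschitz inverse. *)
Lemma push_expand v w : `|v - w| <= 2 * `|push v - push w|.
Proof.
have := ler_normB (push v - push w) ((phi v - phi w) *: e).
have := lip v w.
have -> : v - w = (push v - push w) - (phi v - phi w) *: e.
  by rewrite /push scalerBl opprD addrACA addrK.
set a := push v - push w; set b := (phi v - phi w) *: e.
have : `|b| <= `|phi v - phi w| by rewrite normrZ ler_piMr.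
lra.
Qed.

(** A preimage of [w] has the form [w - s *: e] with [s = phi (w - s *: e)], a scalar equation
    solved by the intermediate value theorem. *)
Lemma push_surj w : exists v, push v = w.
Proof.
pose a := `|phi w|; pose h (s : R) := s - phi (w - s *: e).
have ch : continuous h.
  move=> s; apply: continuousB; first exact: cvg_id.
  apply: (@continuous_comp _ _ _ (fun s : R => w - s *: e) phi s).
    apply: (@continuousB _ _ _ (fun=> w) (fun s : R => s *: e) s); first exact: cvg_cst.
    exact: scalel_continuous.
  exact: differentiable_continuous.
have lph s : `|phi (w - s *: e) - phi w| <= 2^-1 * `|s|.
  apply: le_trans (lip _ _) _; rewrite addrAC subrr add0r normrN normrZ.
  by rewrite ler_wpM2l // ler_piMr.
have a0 : 0 <= a by exact: normr_ge0.
have phia : - a <= phi w <= a by rewrite -ler_norml.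
(* When s is 2a or -2a, [phi (w - s *: e)] differs from [phi w] by at most a, so it lies between -2a
   and 2a. This fixes the sign of [h] at both ends. *)
have h1 : h (- (2 * a)) <= 0.
  have := lph (- (2 * a)); rewrite normrN (@ger0_norm _ (2 * a)) ?mulr_ge0 // ler_norml /h.
  by lra.
have h2 : 0 <= h (2 * a).
  have := lph (2 * a); rewrite (@ger0_norm _ (2 * a)) ?mulr_ge0 // ler_norml /h.
  by lra.
have aa : - (2 * a) <= 2 * a by lra.
have h12 : Num.min (h (- (2 * a))) (h (2 * a)) <= 0 <= Num.max (h (- (2 * a))) (h (2 * a)).
  by rewrite ge_min h1 /= le_max h2 orbT.
have [s _ hs] := IVT aa (continuous_subspaceT ch) h12.
exists (w - s *: e); rewrite /push.
by move: hs => /eqP; rewrite /h subr_eq0 => /eqP <-; rewrite subrK.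
Qed.

Definition pull (w : 'rV[R]_n) := xget 0 [set v | push v = w].

Lemma pullK : cancel pull push.
Proof.
move=> w; rewrite /pull; case: xgetP => [v _ //|Hw].
by have [v /Hw] := push_surj w.
Qed.

Lemma pushK : cancel push pull.
Proof.
move=> v; apply/eqP; rewrite -subr_eq0 -normr_le0.
by apply: le_trans (push_expand _ _) _; rewrite pullK subrr normr0 mulr0.
Qed.

Lemma pullE w : pull w = w - phi (pull w) *: e.
Proof. by rewrite -{2}(pullK w) /push addrK. Qed.

Lemma pull_lip v w : `|pull v - pull w| <= 2 * `|v - w|.
Proof. by apply: le_trans (push_expand _ _) _; rewrite !pullK. Qed.

(** This is the determinant of the differential of [push], a rank-one perturbation of the
    identity. *)
Let denom v := 1 + 'd phi v e.

Let denom_ge v : 2^-1 <= denom v.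
Proof.
have := dphi_le v e; rewrite ler_norml => /andP[H _].
rewrite /denom; move: H e1 (normr_ge0 e) => H E0 E1; lra.
Qed.

(* With [s := phi \o pull], [pull w = w - s w *: e]; the increment [D] of [s]
   satisfies [D = 'd phi y (h - D *: e) + o(h)], to be solved for [D]. *)
Let is_diff_phi_pull w :
  is_diff w (phi \o pull) ((denom (pull w))^-1 \*: 'd phi (pull w)).
Proof.
set y := pull w; set c := denom y.
have c2 : 2^-1 <= c := denom_ge y.
have c0 : 0 < c by lra.
have Llin : linear (c^-1 \*: 'd phi y).
  by move=> b u v /=; rewrite linearP /= !scalerDr !scalerA mulrC.
pose LM := GRing.isLinear.Build _ _ _ _ _ Llin.
pose L : {linear 'rV[R]_n -> R^o} := HB.pack (c^-1 \*: 'd phi y) LM.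
have cL : continuous L.
  by move=> h; apply: continuousZl_tmp; exact: diff_continuous.
have oL : (phi \o pull) \o shift w = cst ((phi \o pull) w) + L +o_ 0 id.
  apply/eqaddoP => eps eps0.
  (* One factor 2 is lost in passing from [k] to [h], by the Lipschitz bound on [pull], and another
     in dividing by [c], which is at least 1/2. *)
  have /eqaddoP/(_ (eps / 4)) := diff_locally (dphi y).
  rewrite divr_gt0 // => /(_ isT); rewrite near_simpl => /nbhs_ballP[d /= d0 Hd].
  rewrite near_simpl; apply/nbhs_ballP; exists (d / 2); first by rewrite /= divr_gt0.
  move=> h; rewrite -ball_normE /ball_ /= sub0r normrN => hd.
  pose k := pull (h + w) - y.
  have kh : `|k| <= 2 * `|h| by have := pull_lip (h + w) w; rewrite addrK.
  have := Hd k; rewrite -ball_normE /ball_ /= sub0r normrN.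
  have -> : `|k| < d by apply: le_lt_trans kh _; lra.
  move=> /(_ isT); rewrite !fctE /= subrK -/y.
  set D := phi (pull (h + w)) - phi y.
  have kE : k = h - D *: e.
    rewrite /k /y [pull (h + w)]pullE [pull w]pullE -/y /D scalerBl.
    by apply/rowP => i; rewrite !mxE; ring.
  rewrite !opprD !addrA -/D kE linearB linearZ /= -kE.
  have -> : D - ('d phi y h - D *: 'd phi y e) = c * (D - c^-1 *: 'd phi y h).
    rewrite /GRing.scale /= mulrBr mulrA divff ?gt_eqF // mul1r /c /denom.
    by ring.
  rewrite normrM gtr0_norm //.
  set X := `|_ - _| => HX.
  have X0 : 0 <= X by exact: normr_ge0.
  have : X * 2^-1 <= c * X by rewrite mulrC ler_wpM2r.
  have : eps / 4 * `|k| <= eps / 4 * (2 * `|h|) by rewrite ler_pM2l ?divr_gt0.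
  lra.
have dE := diff_unique cL oL.
by split=> //; apply/diff_locallyP; rewrite dE.
Qed.

(** Bootstrapping: [pull] is as regular as [phi \o pull], and the differential of [phi \o pull] is a
    smooth expression in [pull], so each order gives the next. *)
Lemma smooth_pull : smooth_on setT pull.
Proof.
have pullD : pull = id + (fun w => (- 1 : R) *: (phi (pull w) *: e)).
  by apply/funext => w; rewrite [LHS]pullE -scaleN1r.
have Ck_pull k : Ck_on k setT (phi \o pull) -> Ck_on k setT pull.
  move=> H; rewrite pullD; apply: Ck_onD; [exact: openT|exact: Ck_on_id|].
  apply: Ck_onZ; [exact: openT|exact: Ck_on_cst|].
  by apply: Ck_onZ; [exact: openT|exact: H|exact: Ck_on_cst].
move=> k; apply: (Ck_pull k); elim: k => [|k IH].
  move=> w _; apply: differentiable_continuous.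
  by have [] := is_diff_phi_pull w.
split=> [w _|v]; first by have [] := is_diff_phi_pull w.
apply: (@Ck_on_eq _ _ _ _ _
  (fun w => (denom (pull w))^-1 *: ('d phi (pull w) v : R^o))).
- exact: openT.
- by move=> w _; have [_ /funeqP/(_ v) E] := is_diff_phi_pull w; exact: (esym E).
have sd u : Ck_on k setT (fun w => 'd phi (pull w) u).
  apply: (@Ck_on_comp _ k _ _ _ _ setT pull (fun y => 'd phi y u)) => //.
  - exact: openT.
  - exact: (Ck_pull k).
  - by have [_] := sphi k.+1; exact.
apply: Ck_onZ; [exact: openT| |exact: sd].
apply: Ck_onV; first exact: openT.
  by move=> w _; have := denom_ge (pull w) => H; apply/eqP; lra.
have -> : (fun w => denom (pull w)) = (fun=> 1 : R) + (fun w => 'd phi (pull w) e).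
  by apply/funext => w.
apply: Ck_onD; first exact: openT.
  exact: Ck_on_cst.
exact: sd.
Qed.

End perturbation_of_identity.

(** * Transplanting a compactly supported map from a chart to the manifold *)

Lemma open_setI_preimage (T T' : topologicalType) (U : set T) (O : set T')
    (f : T -> T') : open U -> (forall x, U x -> {for x, continuous f}) ->
  open O -> open (U `&` f @^-1` O).
Proof.
move=> oU cf oO; rewrite openE => x [Ux Ofx]; apply: filterI.
  exact: open_nbhs_nbhs.
by apply: (cf x Ux); exact: open_nbhs_nbhs.
Qed.

Section transplant.
Context {R : realType} {n : nat} {M : topologicalType}.
Variables (A : set (chart 'rV[R]_n M)) (e : chart 'rV[R]_n M).
Hypotheses (hM : hausdorff_space M) (atA : smooth_atlas A) (Ae : A e).
Variable K : set 'rV[R]_n.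
Hypotheses (cK : compact K) (KU : K `<=` ccod e).

Definition transplant (F : 'rV[R]_n -> 'rV[R]_n) (x : M) : M :=
  if x \in cdom e then cinv e (F (cmap e x)) else x.

Let chA c : A c -> is_chart c. Proof. by case: atA => H _ _; exact: H. Qed.

(** [F] sends [K] into itself: if [F v] were outside [K] it would be a fixed point, so injectivity
    would give [F v = v] and put [v] outside [K] too. *)
Lemma injective_stable_ccod (F : 'rV[R]_n -> 'rV[R]_n) : injective F ->
  (forall v, ~ K v -> F v = v) -> forall v, ccod e v -> ccod e (F v).
Proof.
move=> Finj Fid v ev; have [Kv|/Fid->//] := pselect (K v).
apply: KU; apply: contrapT => /[dup] /Fid /Finj Fv; rewrite Fv.
exact.
Qed.

Lemma transplant_cmap F x : cdom e x -> ccod e (F (cmap e x)) ->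
  cdom e (transplant F x) /\ cmap e (transplant F x) = F (cmap e x).
Proof.
move=> ex eF; rewrite /transplant mem_set //.
by have [_ _ H _ _] := chA Ae; exact: H.
Qed.

Lemma transplantK F G : cancel F G -> (forall v, ccod e v -> ccod e (F v)) ->
  cancel (transplant F) (transplant G).
Proof.
move=> FK FU x; have [_ Hx _ _ _] := chA Ae.
have [ex|nex] := boolP (x \in cdom e); last first.
  by rewrite /transplant (negbTE nex) (negbTE nex).
have {}ex : cdom e x by rewrite inE in ex.
have [ef fE] := @transplant_cmap F x ex (FU _ (Hx _ ex).1).
by rewrite {1}/transplant mem_set // fE FK; exact: (Hx _ ex).2.
Qed.

Lemma transplant_off F x : (forall v, ~ K v -> F v = v) ->
  ~ (cinv e @` K) x -> transplant F x = x.
Proof.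
move=> Fid nKx; rewrite /transplant; case: ifPn => // /set_mem ex.
have [_ /(_ x ex)[_ xE] _ _ _] := chA Ae.
rewrite Fid ?xE // => Kx; apply: nKx.
by exists (cmap e x).
Qed.

Let open_coK : open (~` (cinv e @` K)).
Proof.
apply/closed_openC/(compact_closed hM)/continuous_compact => //.
apply: continuous_in_subspaceT => v /set_mem Kv.
by have [_ _ _ _ H] := chA Ae; exact/H/KU.
Qed.

(** These two open sets cover the manifold. On the first, [transplant F] is [F] read in the chart;
    on the second it is the identity. Continuity and smoothness are checked separately on each. *)
Let covered x : cdom e x \/ ~ (cinv e @` K) x.
Proof.
have [|nex] := pselect (cdom e x); [by left|right=> -[v Kv vx]].
by have [_ _ /(_ v (KU Kv))[]] := chA Ae; rewrite vx.
Qed.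

Lemma smooth_transplant F : smooth_on setT F ->
  (forall v, ~ K v -> F v = v) -> (forall v, ccod e v -> ccod e (F v)) ->
  smooth_map A A (transplant F).
Proof.
move=> sF Fid FU; have [[oe oe'] He He' ce ce'] := chA Ae.
have [_ _ trans] := atA.
have cF : continuous F by move=> v; exact: (sF 0%N v Logic.I).
split=> [x|c d Ac Ad k].
  have [ex|nKx] := covered x.
    have : {near x, cinv e \o F \o cmap e =1 transplant F}.
      apply: filterS (open_nbhs_nbhs (conj oe ex)) => y ey.
      by rewrite /transplant mem_set.
    move=> /[dup] /nbhs_singleton xE nE.
    rewrite /continuous_at -xE; apply: cvg_trans; first exact: near_eq_cvg nE.
    apply: continuous_comp; first exact: ce.
    by apply: continuous_comp; [exact: cF|apply: ce'; apply: FU; exact: (He x ex).1].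
  rewrite /continuous_at (transplant_off Fid nKx).
  have nE : {near x, id =1 transplant F}.
    apply: filterS (open_nbhs_nbhs (conj open_coK nKx)) => y nKy.
    by rewrite transplant_off.
  by apply: cvg_trans; [exact: near_eq_cvg nE|exact: cvg_id].
have [[oc oc'] Hc Hc' cc cc'] := chA Ac.
have [[od _] _ _ _ _] := chA Ad.
apply: Ck_on_points => v [cv /= dfv]; have [ev|nKv] := covered (cinv c v).
(* [W1] and [W2] are the domains of the transition maps from [c] to [e] and from [e] to [d]. On [W]
   the map is the first transition, then [F], then the second transition. *)
- pose W1 := ccod c `&` cinv c @^-1` cdom e.
  pose W2 := ccod e `&` cinv e @^-1` cdom d.
  have oW1 : open W1 by exact: open_setI_preimage.
  have oW2 : open W2 by exact: open_setI_preimage.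
  pose h := F \o (cmap e \o cinv c).
  have sh l : Ck_on l W1 h.
    apply: (@Ck_on_comp _ _ _ _ _ _ setT) => //.
    by have := trans c e Ac Ae l.
  pose W := W1 `&` h @^-1` W2.
  have oW : open W by apply: open_setI_preimage => // x; exact: (sh 0%N).
  exists W; last first.
    split=> //; split; first by apply: FU; exact: (He _ ev).1.
    by move: dfv; rewrite /transplant mem_set.
  apply: (@Ck_on_eq _ _ _ _ _ ((cmap d \o cinv e) \o h)) => //.
    by move=> w /set_mem[[cw ew] _]; rewrite /= /transplant mem_set.
  apply: (@Ck_on_comp _ _ _ _ _ _ W2) => //; first by move=> w [].
    by apply: Ck_on_subset (sh k) => w [].
  exact: trans.
(* Here the map is the identity, so in coordinates it is the transition from [c] to [d]. *)
- pose W := ccod c `&` cinv c @^-1` (cdom d `&` ~` (cinv e @` K)).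
  have oW : open W by apply: open_setI_preimage => //; exact: openI.
  exists W; last by split=> //; split=> //; rewrite -(transplant_off Fid nKv).
  apply: (@Ck_on_eq _ _ _ _ _ (cmap d \o cinv c)) => //.
    by move=> w /set_mem[cw [dw nKw]]; rewrite /= transplant_off.
  by apply: Ck_on_subset (trans c d Ac Ad k) => w [cw []].
Qed.

End transplant.

(** * Growth exponents and bounds for the slow entropies *)

Section limf_esup_comparison.
Context {R : realType} {T : choiceType} {X : filteredType T}.
Local Open Scope ereal_scope.

Lemma le_limf_esup (F : set_system X) {FF : Filter F} (u v : X -> \bar R) :
  (\forall x \near F, u x <= v x) -> limf_esup u F <= limf_esup v F.
Proof.
move=> uv; apply: le_ereal_inf_tmp => _ [V FV <-].
apply: ereal_inf_le; exists (ereal_sup (u @` (V `&` [set x | u x <= v x]))).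
  by exists (V `&` [set x | u x <= v x]) => //; exact: filterI.
apply: ge_ereal_sup => _ [x [Vx uvx] <-].
by apply: le_trans uvx _; apply: ereal_sup_ubound; exists x.
Qed.

Lemma limf_esup_le_cst (F : set_system X) {FF : Filter F} (u : X -> \bar R) c :
  (\forall x \near F, u x <= c) -> limf_esup u F <= c.
Proof.
move=> uc; apply: ereal_inf_le; exists (ereal_sup (u @` [set x | u x <= c])).
  by exists [set x | u x <= c].
by apply: ge_ereal_sup => _ [x ux <-].
Qed.

Lemma limf_esup_ge_cst (F : set_system X) {FF : ProperFilter F} (u : X -> \bar R) c :
  (\forall x \near F, c <= u x) -> c <= limf_esup u F.
Proof.
move=> uc; apply: le_ereal_inf_tmp => _ [V FV <-].
have [x [Vx cu]] := filter_ex (filterI FV uc).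
by apply: le_trans cu _; apply: ereal_sup_ubound; exists x.
Qed.

End limf_esup_comparison.

Section growth.
Context {R : realType} (a : R -> R -> R).
Hypothesis sa : scale_family a.
Implicit Types u v : R -> \bar R.

Let a_gt0 chi : 0 < chi -> \forall T \near +oo, 0 < a chi T.
Proof.
move=> chi0; have [H _ _] := sa; near=> T.
by apply: H => //; near: T; exact: nbhs_pinfty_gt.
Unshelve. all: by end_near. Qed.

Lemma le_growth_exponent u v :
  (\forall T \near +oo, (u T <= v T)%E) ->
  (growth_exponent a u <= growth_exponent a v)%E.
Proof.
move=> uv; apply: le_ereal_sup => _ [->|[chi [chi0 H] <-]]; first by left.
right; exists chi => //; split=> //; apply: lt_le_trans H _.
apply: le_limf_esup; near=> T.
apply: lee_wpmul2r; first by rewrite lee_fin invr_ge0 ltW //; near: T; exact: a_gt0.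
by near: T.
Unshelve. all: by end_near. Qed.

(** Every scale tends to infinity, so the ratio of a bounded [u] to it has limsup at most 0 and only
    the conventional value 0 is left in the supremum. *)
Lemma growth_exponent_bounded u (C : R) : 0 < C ->
  (\forall T \near +oo, (u T <= C%:E)%E) -> growth_exponent a u = 0%E.
Proof.
move=> C0 uC; apply/eqP; rewrite eq_le; apply/andP; split; last first.
  by apply: ereal_sup_ubound; left.
apply: ge_ereal_sup => _ [-> //|[chi [chi0 H] <-]].
exfalso; move: H; apply/negP; rewrite -leNgt.
apply/lee_addgt0Pr => e e0; rewrite add0e; apply: limf_esup_le_cst.
have [_ /(_ _ chi0)/cvgryPge aoo _] := sa.
near=> T.
have aT : 0 < a chi T by near: T; exact: a_gt0.
have uT : (u T <= C%:E)%E by near: T.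
apply: (@le_trans _ _ (C%:E * (a chi T)^-1%:E)%E).
  by apply: lee_wpmul2r => //; rewrite lee_fin invr_ge0 ltW.
rewrite -EFinM lee_fin ler_pdivrMr // mulrC -ler_pdivrMr //.
by near: T; exact: aoo.
Unshelve. all: by end_near. Qed.

Lemma growth_exponent_ge u chi : 0 < chi ->
  (\forall T \near +oo, ((a chi T)%:E <= u T)%E) ->
  (chi%:E <= growth_exponent a u)%E.
Proof.
move=> chi0 au; apply: ereal_sup_ubound; right; exists chi => //; split=> //.
apply: (@lt_le_trans _ _ 1%E) => //; apply: limf_esup_ge_cst.
near=> T.
have aT : 0 < a chi T by near: T; exact: a_gt0.
rewrite -(@divff _ (a chi T)) ?gt_eqF // EFinM; apply: lee_wpmul2r.
  by rewrite lee_fin invr_ge0 ltW.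
by near: T.
Unshelve. all: by end_near. Qed.

Lemma htop_ge (X : metricType R) (f : X -> X) (eps0 chi : R) :
  0 < eps0 -> 0 < chi ->
  (forall eps, 0 < eps -> eps <= eps0 ->
    \forall T \near +oo, ((a chi T)%:E <= covering_number f eps T)%E) ->
  (chi%:E <= htop a f)%E.
Proof.
move=> eps00 chi0 H; apply: lime_ge.
  (* Smaller radii need larger covers, so the exponent is monotone in the radius and its limit
     exists. *)
  apply: nonincreasing_at_right_is_cvge; near=> d => x y _ _ xy.
  apply: le_growth_exponent; near=> T.
  apply: le_ereal_inf => _ [s Hs <-]; exists s => // z.
  have [c cs Hc] := Hs z; exists c => // t tT.
  exact: le_ball xy _ (Hc t tT).
near=> eps; apply: growth_exponent_ge => //; apply: H.
  by near: eps; exact: nbhs_right_gt.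
by near: eps; exact: nbhs_right_le.
Unshelve. all: by end_near. Qed.

Lemma hmu_le0 (X : ptopologicalType) (f : X -> X) (mu : probability (borel X) R) :
  (forall k (P : 'I_k -> set (borel X)) eps, measurable_partition P -> 0 < eps ->
    exists2 C : R, 0 < C &
      \forall T \near +oo, (hamming_covering_number f mu P eps T <= C%:E)%E) ->
  (hmu a f mu <= 0)%E.
Proof.
move=> H; apply: ge_ereal_sup => _ [k [P [mP ->]]].
suff -> : lim (growth_exponent a (hamming_covering_number f mu P eps)
               @[eps --> 0^'+]) = 0%E by [].
apply: cvg_lim => //; apply: (@cvg_trans _ (0%E @[eps --> (0 : R)^'+])); last exact: cvg_cst.
apply: near_eq_cvg; near=> eps.
have [|C C0 HC] := H k P eps mP; first by near: eps; exact: nbhs_right_gt.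
by rewrite (growth_exponent_bounded C0).
Unshelve. all: by end_near. Qed.

End growth.

(** * Powers of T as a family of scales *)

Lemma scale_family_powR (R : realType) : scale_family (fun chi T : R => T `^ chi).
Proof.
have powR_cvgy (chi : R) : 0 < chi -> T `^ chi @[T --> +oo] --> +oo.
  move=> chi0; apply/cvgryPge => B; pose B' := Num.max B 1.
  have B'0 : 0 < B' by rewrite lt_max ltr01 orbT.
  near=> T; have BT : B' `^ chi^-1 <= T by near: T; apply: nbhs_pinfty_ge; exact: num_real.
  apply: (@le_trans _ _ B'); first by rewrite le_max lexx.
  have -> : B' = (B' `^ chi^-1) `^ chi.
    by rewrite -powRrM mulVf ?gt_eqF // powRr1 // ltW.
  apply: ge0_ler_powR => //; first exact: ltW.
    exact: powR_ge0.
  by rewrite nnegrE (le_trans _ BT) // powR_ge0.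
split=> [chi T _ T0|chi chi0|chi chi' chi0 chichi'].
- exact: powR_gt0.
- exact: powR_cvgy.
- apply/cvgrPdist_le => e e0.
  (* The quotient is the inverse of T to the power [chi' - chi], which tends to infinity. *)
  have := powR_cvgy _ (eq_ind_r (fun b => is_true b) chichi' (subr_gt0 chi chi')).
  move=> /cvgryPge/(_ e^-1) near_e; near=> T.
  have T0 : 0 < T by near: T; exact: nbhs_pinfty_gt.
  have eT : e^-1 <= T `^ (chi' - chi) by near: T.
  rewrite sub0r normrN -powRB; last by rewrite (gt_eqF T0) implybT.
  rewrite -opprB powRN ger0_norm ?invr_ge0 ?powR_ge0 //.
  by rewrite -[leRHS]invrK lef_pV2 ?posrE ?invr_gt0 ?powR_gt0.
Unshelve. all: by end_near. Qed.

(** * Measurability of Hamming balls *)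

Lemma measurable_continuous_preimage (X : ptopologicalType) (f : X -> X)
    (B : set (borel X)) : continuous f -> measurable B ->
  measurable (f @^-1` B : set (borel X)).
Proof.
move=> cf mB.
have mf : measurable_fun [set: borel X] (f : borel X -> borel X).
  apply: (@measurability _ _ (borel X) (borel X) setT f (@open X)) => //.
  move=> _ [V oV <-]; rewrite setTI; apply: sub_sigma_algebra.
  by move: cf => /continuousP; exact.
by have := mf measurableT B mB; rewrite setTI.
Qed.

(* The set [B] is a union of cells of the finite partition generated by the
   [C s], [s < N]. *)
Lemma measurable_finite_itinerary d (X : measurableType d) (N : nat)
    (C : nat -> set X) (B : set X) : (forall s, measurable (C s)) ->
  (forall x y, (forall s, (s < N)%N -> C s x <-> C s y) -> B x -> B y) ->
  measurable B.
Proof.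
move=> mC CB.
pose cell (b : {ffun 'I_N -> bool}) :=
  \bigcap_(s in [set: 'I_N]) (if b s then C s else ~` C s).
pose itin (x : X) := [ffun s : 'I_N => x \in C s].
have itinP x : cell (itin x) x.
  by move=> s _; rewrite ffunE; case: ifPn; rewrite ?inE // => /negP; rewrite inE.
have cellP b x y : cell b x -> cell b y -> forall s, (s < N)%N -> C s x <-> C s y.
  move=> cbx cby s sN; have := cby (Ordinal sN) Logic.I.
  have := cbx (Ordinal sN) Logic.I; case: ifP => _ /=; tauto.
rewrite (_ : B = \bigcup_(b in itin @` B) cell b).
  apply: fin_bigcup_measurable; first exact: finite_finset.
  move=> b _; apply: fin_bigcap_measurable; first exact: finite_finset.
  by move=> s _; case: ifP => _ //; exact: measurableC.
apply/seteqP; split=> [x Bx|y [_ [x Bx <-] cy]].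
  by exists (itin x) => //; exists x.
by apply: CB Bx; exact: cellP (itinP x) cy.
Qed.

(** The Hamming distance from [x] to [y] depends on [y] only through the conditions [C s y] at the
    finitely many times s < T, all of which satisfy s <= [Num.truncn T]. *)
Lemma measurable_hamming_ball (R : realType) (X : ptopologicalType) (f : X -> X)
    k (P : 'I_k -> set (borel X)) (T eps : R) (x : X) : continuous f ->
  (forall i, measurable (P i)) -> measurable (hamming_ball f P T x eps).
Proof.
move=> cf mP.
pose C s : set (borel X) :=
  iter s f @^-1` \bigcup_(i in [set i | P i (iter s f x)]) P i.
have cfs s : continuous (iter s f).
  elim: s => [|s IH] y /=; first exact: cvg_id.
  by apply: continuous_comp; [exact: IH|exact: cf].
apply: (@measurable_finite_itinerary _ _ (Num.truncn T).+1 C) => [s|y z yz].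
  apply: measurable_continuous_preimage => //.
  by apply: fin_bigcup_measurable => // i _; exact: mP.
rewrite /hamming_ball /= /hamming.
suff -> : [set s : nat | s%:R < T /\ ~ exists i, P i (iter s f x) /\ P i (iter s f y)] =
  [set s : nat | s%:R < T /\ ~ exists i, P i (iter s f x) /\ P i (iter s f z)] by [].
have CE w s : C s w <-> exists i, P i (iter s f x) /\ P i (iter s f w).
  by split=> [[i ? ?]|[i [? ?]]]; exists i.
apply/seteqP; split=> s [sT nE]; split=> //.
all: have sN : (s < (Num.truncn T).+1)%N by
  rewrite ltnS truncn_ge_nat ?(ltW sT) // (le_trans _ (ltW sT)).
all: by move=> /CE H; apply: nE; apply/CE; apply/(yz s sN).
Qed.

(** * Maps that strictly raise a function [h] on an invariant set [D] and fix all other points *)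

Section wandering.
Context {R : realType} {M : pmetricType R} (f g : M -> M) (D : set M) (h : M -> R).
Hypotheses (cf : continuous f) (gK : cancel g f).
Hypothesis fixD : forall x, ~ D x -> f x = x.
Hypothesis pushD : forall x, D x -> D (f x) /\ h x < h (f x).
Hypothesis open_gt : forall q, open (D `&` [set x | q < h x]).
Hypothesis open_lt : forall q, open (D `&` [set x | h x < q]).

(** Each superlevel set [B q] lies in its preimage under [f], which has the same measure, so the
    difference is null. A point [x] of [D] lies in such a difference for any rational q strictly
    between [h x] and [h (f x)], and countably many null sets suffice. *)
Lemma invariant_wandering0 (mu : probability (borel M) R) :
  invariant_probabilities f mu -> mu.-negligible (D : set (borel M)).
Proof.
move=> inv.
pose B q : set (borel M) := D `&` [set x | q < h x].
have mB q : measurable (B q) by apply: sub_sigma_algebra; exact: open_gt.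
have mfB q : measurable (f @^-1` B q : set (borel M)).
  exact: measurable_continuous_preimage.
have BfB q : B q `<=` f @^-1` B q.
  by move=> x [/pushD[Dfx hx] qh]; split=> //=; exact: lt_trans hx.
pose qn (n : nat) : R := ratr (odflt (0 : rat) (pickle_inv n)).
apply: (@negligibleS _ (borel M) R mu (\bigcup_n ((f @^-1` B (qn n)) `\` B (qn n)))).
  move=> x Dx; have [Dfx /rat_in_itvoo[q]] := pushD Dx.
  rewrite in_itv /= => /andP[hq qh]; exists (choice.pickle q) => //.
  rewrite /qn pickleK_inv /=; split=> // -[_ /=].
  by rewrite ltNge (ltW hq).
apply: negligible_bigcup => n; apply/negligibleP; first exact: measurableD.
rewrite measureD //; last by rewrite ltey_eq fin_num_measure.
have -> : (f @^-1` B (qn n)) `&` B (qn n) = B (qn n) by apply/setIidr/BfB.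
have E := inv _ (mB (qn n)).
rewrite [X in (X - _)%E]E subee //; exact: fin_num_measure.
Qed.

(** Fixed points in a common cell are at Hamming distance 0 for every [T], so one centre per cell
    covers the complement of [D], which has full measure. The bound [k.+1] is visibly positive, as
    [hmu_le0] requires. *)
Lemma wandering_hamming_bounded (mu : probability (borel M) R) k
    (P : 'I_k -> set (borel M)) (eps : R) : invariant_probabilities f mu ->
  measurable_partition P -> 0 < eps ->
  \forall T \near +oo, (hamming_covering_number f mu P eps T <= k.+1%:R%:E)%E.
Proof.
move=> inv [mP [coverP _ _]] eps0.
(* If [P i] lies inside [D], the centre is the default [point] and no point of that cell needs to be
   covered. *)
pose c i : M := xget point (P i `&` ~` D).
pose s := [seq c i | i <- enum 'I_k].
near=> T.
have T0 : 0 < T by near: T; exact: nbhs_pinfty_gt.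
apply: (@le_trans _ _ (size s)%:R%:E); last first.
  by rewrite lee_fin ler_nat size_map size_enum_ord.
apply: ereal_inf_lbound; exists s => //=.
set U := \bigcup_(_ in _) _.
have mU : measurable U.
  apply: fin_bigcup_measurable; first exact: finite_seq.
  by move=> x _; exact: measurable_hamming_ball.
have mD : measurable (D : set (borel M)).
  rewrite (_ : D = \bigcup_n (D `&` [set x | - n%:R < h x])).
    by apply: bigcupT_measurable => n; apply: sub_sigma_algebra; exact: open_gt.
  apply/seteqP; split=> [x Dx|x [n _ []]//].
  exists (Num.truncn `|h x|).+1 => //; split=> //=.
  by rewrite ltrNl (le_lt_trans (ler_norm _)) // normrN truncnS_gt.
have DU : ~` D `<=` U.
  move=> x nDx; have : [set: borel M] x by [].
  rewrite -coverP => -[i _ Pix].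
  have [Pc nDc] : (P i `&` ~` D) (c i).
    by rewrite /c; case: xgetP => [y -> //|/(_ x)[]].
  exists (c i); first by rewrite /= map_f // mem_enum.
  rewrite /hamming_ball /= /hamming.
  have fixn y n : ~ D y -> iter n f y = y.
    by move=> nDy; elim: n => //= n ->; exact: fixD.
  rewrite (_ : [set s0 : nat | _] = set0); last first.
    by apply/seteqP; split=> // t [_ []]; exists i; rewrite !fixn.
  by rewrite fset_set0 cardfs0 mul0r.
have : (mu (~` D) <= mu U)%E by apply: le_measure => //; rewrite inE //; exact: measurableC.
rewrite probability_setC // (negligibleP _ mD).1; last exact: invariant_wandering0.
rewrite sube0; apply: lt_le_trans.
by rewrite lte_fin ltrBlDr ltrDl.
Unshelve. all: by end_near. Qed.

(** Along the forward orbit [h] stays at least [h (f p)], so the orbit never returns to the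
    neighbourhood [O] of [p]. For i < j <= T the points g^i p and g^j p are told apart at time j,
    when the latter is at [p] and the former at f^(j-i) p. *)
Lemma wandering_covering_ge p : D p -> exists2 eps0 : R, 0 < eps0 &
  forall eps T, 0 < eps -> eps <= eps0 -> 0 <= T ->
    (T%:E <= covering_number f eps T)%E.
Proof.
move=> Dp; pose O := D `&` [set x | h x < h (f p)].
have Op : O p by split=> //; exact: (pushD Dp).2.
have orbitD m : D (iter m.+1 f p) /\ h (f p) <= h (iter m.+1 f p).
  elim: m => [|m [Dm hm]]; first by split=> //; exact: (pushD Dp).1.
  have [Dm1 hm1] := pushD Dm; split=> //.
  exact: le_trans hm (ltW hm1).
have nO m : ~ O (iter m.+1 f p) by move=> [_ /=]; rewrite ltNge (orbitD m).2.
have /nbhs_ballP[d /= d0 dO] : nbhs p O by apply: open_nbhs_nbhs; split=> //; exact: open_lt.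
(* Two points of one Bowen ball are within twice its radius at each time, so half of [d] is small
   enough. *)
exists (d / 2); first exact: divr_gt0.
move=> eps T eps0 epsd T0.
have fgK j x : iter j f (iter j g x) = x.
  by elim: j x => // j IH x; rewrite iterSr /= gK IH.
apply: le_ereal_inf_tmp => _ [s Hs <-]; rewrite lee_fin.
have /choice[ctr Hctr] : forall j, exists x, x \in s /\ bowen_ball f T x eps (iter j g p).
  by move=> j; have [x xs Hx] := Hs (iter j g p); exists x.
(* The number of integers j with 0 <= j <= T, which exceeds [T]. *)
pose N := (Num.truncn T).+1.
suff : (N <= size s)%N.
  by rewrite -(ler_nat R); apply: le_trans; rewrite ltW // truncnS_gt.
rewrite -(size_iota 0 N) -(size_map ctr); apply: uniq_leq_size; last first.
  by move=> _ /mapP[j _ ->]; have [] := Hctr j.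
have neq i j : (i < j)%N -> (j < N)%N -> ctr i <> ctr j.
  move=> ij jN cij.
  have jT : j%:R <= T by rewrite -truncn_ge_nat.
  have E : iter j f (iter i g p) = iter (j - i.+1).+1 f p.
    by rewrite -[in LHS](subnK ij) addnS -addSn iterD fgK.
  have := (Hctr i).2 j jT; have := (Hctr j).2 j jT; rewrite -cij fgK E => b1 b2.
  apply: (nO (j - i.+1)%N); apply: dO.
  apply: le_ball (ball_triangle (ball_sym b1) b2).
  by rewrite (splitr d) lerD.
rewrite map_inj_in_uniq ?iota_uniq // => i j.
rewrite !mem_iota !add0n /= => iN jN cij.
by case: (ltngtP i j) => // [/neq/(_ jN)|/neq/(_ iN)/nesym].
Qed.

End wandering.

(** * Exclusion of dimension 0 *)

(** In dimension 0 a chart domain is a single point, so [point] is isolated and by continuity is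
    fixed by [S t] for all small t. A free action allows this for integers only. *)
Lemma free_circle_action_dim_gt0 (R : realType) (n : nat) (M : pmetricType R)
    (A : set (chart 'rV[R]_n M)) (S : R -> M -> M) :
  smooth_atlas A -> free_circle_action A S -> (0 < n)%N.
Proof.
case: n A => // A [chA covA _] [S0 _ _ Sfree [cS _]]; exfalso.
have [c Ac cp] := covA point.
have [[oc _] Hc _ _ _] := chA c Ac.
have cdom1 x : cdom c x -> x = point.
  move=> cx; rewrite -(Hc x cx).2 -(Hc _ cp).2; congr (cinv c _).
  by apply/rowP => -[].
have cSp : {for 0, continuous (fun t : R => S t point)}.
  apply: (@continuous_comp _ _ _ (fun t : R => (t : R^o, point : M)) (fun q => S q.1 q.2) 0).
    exact: (cvg_pair cvg_id (cvg_cst point)).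
  exact: cS.
have : nbhs (0 : R) [set t | S t point = point].
  have N : nbhs (S 0 point) (cdom c) by rewrite S0; exact: open_nbhs_nbhs.
  exact: filterS (fun t => @cdom1 (S t point)) (cSp _ N).
move=> /nbhs_ballP[d /= d0 dS].
pose t := Num.min (d / 2) 2^-1.
have t0 : 0 < t by rewrite lt_min divr_gt0 //= invr_gt0.
have td : t < d by rewrite gt_min; apply/orP; left; lra.
have t1 : t < 1 by rewrite gt_min; apply/orP; right; lra.
have /Sfree/intrP[m tm] : S t point = point.
  by apply: dS; rewrite -ball_normE /ball_ /= sub0r normrN gtr0_norm.
by move: t0 t1; rewrite tm ltr0z -[1]/(1%:~R) ltr_int; lia.
Qed.

(** * The diffeomorphism of the manifold and its moved points *)

Section chart_push.
Context {R : realType} {n : nat} {M : pmetricType R}.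
Variables (A : set (chart 'rV[R]_n.+1 M)) (c : chart 'rV[R]_n.+1 M).
Hypotheses (atA : smooth_atlas A) (Ac : A c).
Variables (phi : 'rV[R]_n.+1 -> R) (K : set 'rV[R]_n.+1).
Hypotheses (sphi : smooth_on setT phi) (phi_ge0 : forall v, 0 <= phi v).
Hypotheses (cK : compact K) (KU : K `<=` ccod c) (phi0 : forall v, ~ K v -> phi v = 0).
Hypothesis dphi_le : forall v h, `|'d phi v h| <= 2^-1 * `|h|.

Let e0 : 'rV[R]_n.+1 := delta_mx ord0 ord0.

Let e0_le1 : `|e0| <= 1.
Proof.
rewrite /Num.Def.normr /= mx_normrE; apply/bigmax_leP; split=> // -[i j] _ /=.
by rewrite mxE; case: (_ && _); rewrite ?normr1 ?normr0.
Qed.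

Let F := push phi e0.
Let G := pull phi e0.
Let FK : cancel F G := pushK sphi dphi_le e0_le1.
Let GK : cancel G F := pullK sphi dphi_le e0_le1.
Let Fid v : phi v = 0 -> F v = v.
Proof. by rewrite /F /push => ->; rewrite scale0r addr0. Qed.
Let FidK v : ~ K v -> F v = v. Proof. by move=> /phi0/Fid. Qed.
Let GidK v : ~ K v -> G v = v. Proof. by move=> /FidK {1}<-; exact: FK. Qed.
Let FU := injective_stable_ccod KU (can_inj FK) FidK.
Let GU := injective_stable_ccod KU (can_inj GK) GidK.

Definition chart_push : M -> M := transplant c F.
Definition chart_pull : M -> M := transplant c G.

Lemma chart_pushK : cancel chart_push chart_pull.
Proof. exact: (transplantK atA Ac FK FU). Qed.

Lemma chart_pullK : cancel chart_pull chart_push.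
Proof. exact: (transplantK atA Ac GK GU). Qed.

Lemma diffeomorphism_chart_push : diffeomorphism A chart_push.
Proof.
have hM : hausdorff_space M by exact: metric_hausdorff.
split; first exact: (smooth_transplant hM atA Ac cK KU (smooth_push _ sphi)).
exists chart_pull; split; [exact: chart_pushK|exact: chart_pullK|].
exact: (smooth_transplant hM atA Ac cK KU (smooth_pull sphi dphi_le e0_le1)).
Qed.

(** [moved] and [height] are the [D] and [h] to which the results on wandering maps are applied. *)
Definition moved : set M := cdom c `&` [set x | 0 < phi (cmap c x)].
Definition height (x : M) : R := cmap c x ord0 ord0.

Lemma chart_push_fix x : ~ moved x -> chart_push x = x.
Proof.
move=> nx; have [chA _ _] := atA; have [_ Hc _ _ _] := chA c Ac.
rewrite /chart_push /transplant; case: ifPn => // /set_mem cx.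
rewrite Fid; first exact: (Hc x cx).2.
apply/eqP; rewrite eq_le phi_ge0 andbT leNgt; apply/negP => px.
exact: nx.
Qed.

(** In the chart the first coordinate grows by [phi], which is positive. If [phi] vanished at the
    image, the image would be a fixed point of the injective map [F], hence equal to the original
    point, contradicting the growth. *)
Lemma chart_push_moved x :
  moved x -> moved (chart_push x) /\ height x < height (chart_push x).
Proof.
move=> [cx /= px]; have [chA _ _] := atA; have [_ Hc _ _ _] := chA c Ac.
have [cfx fxE] := transplant_cmap atA Ac cx (FU (Hc x cx).1).
have FE : F (cmap c x) ord0 ord0 = height x + phi (cmap c x).
  by rewrite /F /push !mxE eqxx mulr1.
have hx : height x < height (chart_push x).
  by rewrite {2}/height fxE FE ltrDl.
split=> //; split=> //=; rewrite fxE lt_neqAle phi_ge0 andbT eq_sym.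
apply/eqP => /Fid/(can_inj FK) Fx.
by move: hx; rewrite {2}/height fxE Fx ltxx.
Qed.

Let open_moved (Q : set R) : open Q -> open (moved `&` [set x | Q (height x)]).
Proof.
move=> oQ; have [chA _ _] := atA; have [[oc _] _ _ cc _] := chA c Ac.
have cphi : continuous phi by move=> v; exact: (sphi 0%N v Logic.I).
rewrite (_ : _ `&` _ = cdom c `&` cmap c @^-1`
    ([set v | 0 < phi v] `&` [set v | Q (v ord0 ord0)])); last first.
  by apply/seteqP; split=> x /=; rewrite /moved /height /=; tauto.
apply: open_setI_preimage => //; apply: openI.
  by apply: (@open_comp _ _ phi [set y | 0 < y]) => // v _; exact: cphi.
by apply: (@open_comp _ _ (fun v : 'rV[R]_n.+1 => v ord0 ord0) Q) => // v _; exact: coord_continuous.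
Qed.

Lemma open_moved_gt q : open (moved `&` [set x | q < height x]).
Proof. exact: (open_moved (@open_gt _ q)). Qed.

Lemma open_moved_lt q : open (moved `&` [set x | height x < q]).
Proof. exact: (open_moved (@open_lt _ q)). Qed.

End chart_push.

Theorem corollary4p10 (R : realType) (n : nat) (M : pmetricType R)
    (A : set (chart 'rV[R]_n M)) :
  smooth_atlas A -> compact [set: M] ->
  (exists S : R -> M -> M, free_circle_action A S) ->
  exists (f : M -> M) (a : R -> R -> R),
    [/\ diffeomorphism A f, scale_family a &
        (ereal_sup [set hmu a f mu | mu in invariant_probabilities f]
           < htop a f)%E].
Proof.
move=> atA _ [S actS]; have := free_circle_action_dim_gt0 atA actS.
case: n A atA S actS => // n A atA _ _ _.
have [chA covA _] := atA; have [c Ac cp] := covA point.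
have [[_ oc] Hc _ _ _] := chA c Ac.
(* The bump is positive at the image of [point], so [point] itself is moved. *)
have [phi [K [sphi [phi_ge0 phi_gt0] [cK KU] phi0 dphi_le]]] :=
  smooth_bump oc (Hc _ cp).1.
have df := diffeomorphism_chart_push atA Ac sphi cK KU phi0 dphi_le.
have [[cf _] _] := df.
have gK := chart_pullK atA Ac sphi KU phi0 dphi_le.
have fixD := chart_push_fix atA Ac phi_ge0.
have pushD := chart_push_moved atA Ac sphi phi_ge0 KU phi0 dphi_le.
have oG := open_moved_gt atA Ac sphi.
have oL := open_moved_lt atA Ac sphi.
pose a (chi T : R) := T `^ chi.
have sa : scale_family a := scale_family_powR R.
exists (chart_push c phi), a; split=> //.
apply: (@le_lt_trans _ _ 0%E).
  apply: ge_ereal_sup => _ [mu inv <-]; apply: hmu_le0 => // k P eps mP eps0.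
  exists k.+1%:R => //.
  exact: (wandering_hamming_bounded cf fixD pushD oG inv mP eps0).
(* At exponent 1 the scale is [T] itself, which the covering numbers dominate. *)
apply: (@lt_le_trans _ _ 1%E) => //.
have [eps0 eps00 Hcov] := wandering_covering_ge gK pushD oL (conj cp phi_gt0).
apply: (htop_ge sa eps00 ltr01) => eps eps_gt0 epsle.
near=> T; have T0 : 0 <= T by near: T; apply: nbhs_pinfty_ge; exact: num_real.
by rewrite /a powRr1 //; exact: Hcov.
Unshelve. all: by end_near. Qed.
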